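(* Let $n\ge 1$ be an integer. For real numbers $a_1,\dots,a_n$ put $$C(t)=\sum_{j=1}^{n}a_j\cos(2j-1)t,\qquad S(t)=\sum_{j=1}^{n}a_j\sin(2j-1)t .$$ Let $$J_2=\inf_{(a_1,\dots,a_n)\in\mathbb R^n,\ \sum_{j=1}^n a_j=1}\left[\max_{t\in[0,\pi/2]}\left\{|S(t)|:\ C(t)=0\right\}\right].$$ Then $$J_2=\frac1n .$$ *)

(* Defs.v *)
From HB Require Import structures.
From mathcomp Require Import all_boot all_order all_algebra.
From mathcomp Require Import all_classical all_reals all_analysis.

Set Implicit Arguments.
Unset Strict Implicit.
Unset Printing Implicit Defensive.

Import Order.TTheory GRing.Theory Num.Theory.
Import numFieldNormedType.Exports.

Local Open Scope classical_set_scope.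
Local Open Scope ring_scope.

(* The coefficients a_1, ..., a_n are the entries of a row vector indexed from
   0, so the frequency 2j - 1 of the j-th term becomes 2j + 1. *)
Definition cosine_sum (R : realType) (n : nat) (a : 'rV[R]_n) (t : R) : R :=
  \sum_(j < n) a ord0 j * cos ((2 * j + 1)%:R * t).

Definition sine_sum (R : realType) (n : nat) (a : 'rV[R]_n) (t : R) : R :=
  \sum_(j < n) a ord0 j * sin ((2 * j + 1)%:R * t).

Definition sine_values (R : realType) (n : nat) (a : 'rV[R]_n) : set R :=
  [set `|sine_sum a t| | t in [set t | 0 <= t <= pi / 2 /\ cosine_sum a t = 0]].

(* This supremum is a maximum: see max_sineP. *)
Definition max_sine (R : realType) (n : nat) (a : 'rV[R]_n) : R :=
  sup (sine_values a).

Definition J2 (R : realType) (n : nat) : R :=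
  inf [set max_sine a | a in [set a : 'rV[R]_n | \sum_(j < n) a ord0 j = 1]].

Lemma continuous_cosine_sum (R : realType) (n : nat) (a : 'rV[R]_n) :
  continuous (cosine_sum a).
Proof.
move=> t; rewrite /cosine_sum.
apply: continuous_big => [|j _].
  exact: add_continuous.
move=> x; apply: cvgM; first exact: cvg_cst.
apply: continuous_comp; last exact: continuous_cos.
by apply: cvgM; [exact: cvg_cst | exact: cvg_id].
Qed.

Lemma continuous_sine_sum (R : realType) (n : nat) (a : 'rV[R]_n) :
  continuous (sine_sum a).
Proof.
move=> t; rewrite /sine_sum.
apply: continuous_big => [|j _].
  exact: add_continuous.
move=> x; apply: cvgM; first exact: cvg_cst.
apply: continuous_comp; last exact: continuous_sin.
by apply: cvgM; [exact: cvg_cst | exact: cvg_id].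
Qed.

Lemma cosine_sum_pihalf (R : realType) (n : nat) (a : 'rV[R]_n) :
  cosine_sum a (pi / 2) = 0.
Proof.
rewrite /cosine_sum big1// => j _.
suff -> : cos ((2 * j + 1)%:R * (pi / 2)) = 0 :> R by rewrite mulr0.
elim: (j : nat) => [|k IHk]; first by rewrite muln0 add0n mul1r cos_pihalf.
have -> : (2 * k.+1 + 1)%:R * (pi / 2) = (2 * k + 1)%:R * (pi / 2) + pi :> R.
  rewrite mulnS -addnA natrD mulrDl addrC; congr (_ + _).
  by rewrite mulrCA mulfV ?mulr1 ?pnatr_eq0.
by rewrite cosDpi IHk oppr0.
Qed.

Lemma max_sineP (R : realType) (n : nat) (a : 'rV[R]_n) :
  sine_values a (max_sine a) /\ ubound (sine_values a) (max_sine a).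
Proof.
pose A : set R := [set t | 0 <= t <= pi / 2 /\ cosine_sum a t = 0].
have AE : A = `[0, pi / 2]%classic `&` cosine_sum a @^-1` [set 0].
  by apply/seteqP; split => x /=; rewrite in_itv/=.
have A0 : A !=set0.
  exists (pi / 2); split; last exact: cosine_sum_pihalf.
  by rewrite lexx andbT divr_ge0// pi_ge0.
have cptA : compact A.
  rewrite AE; apply: (subclosed_compact _ (@segment_compact _ 0 (pi / 2))).
    apply: closedI; first exact: interval_closed.
    apply: preimage_closed; last exact: closed_eq.
    by move=> x _; exact: continuous_cosine_sum.
  by move=> x [].
have cS : {within A, continuous (fun t => `|sine_sum a t|)}.
  apply: continuous_subspaceT => x.
  by apply: continuous_comp; [exact: continuous_sine_sum | exact: norm_continuous].
have [c /set_mem Ac cmax] := compact_EVT_max A0 cptA cS.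
have cub : ubound (sine_values a) `|sine_sum a c|.
  by move=> _ [t At <-]; apply: cmax; exact/mem_set.
have cin : sine_values a `|sine_sum a c| by exists c.
suff -> : max_sine a = `|sine_sum a c| by [].
apply/eqP; rewrite eq_le; apply/andP; split.
  by apply: ge_sup => //; exists `|sine_sum a c|.
by apply: ub_le_sup => //; exists `|sine_sum a c|.
Qed.

(* Main.v *)
(* Put x = cos 2t.  Then 2 cos t C(t) = p(x) with deg p <= n, p(-1) = 0 and
   p(1) = 2 (sum of the a_j), and at a zero t of C the value S(t) / sin t is the
   average of the polynomial p / (X - x) over the n points cos (2 pi k / n).
   Lower bound: pick nonnegative weights r_i at roots y_i = cos 2t_i of p such
   that W, the sum of the r_i p / (X - y_i), is nonnegative on [-1, 1].  As 1 is
   one of the n nodes,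
     W(1) / n <= average of W = sum of r_i S(t_i) / sin t_i <= mu W(1),
   where mu is the maximum of |S| over the zeros of C: indeed sin t_i <= 1 gives
   1 / sin t_i <= 1 / sin^2 t_i = 2 / (1 - y_i) = p(1) / (1 - y_i).
   Upper bound: for a_j = (2n - 2j + 1) / n^2 one has
   n^2 C(t) = cos t sin^2(nt) / sin^2 t >= 0 and S(pi/2) = 1/n.  The zeros of C
   in [0, pi/2) are removed by a small multiple of cos t. *)
Require Import Defs.
From HB Require Import structures.
From mathcomp Require Import all_boot all_order all_algebra.
From mathcomp Require Import all_classical all_reals all_analysis.
From mathcomp Require Import ring lra.

Set Implicit Arguments.
Unset Strict Implicit.
Unset Printing Implicit Defensive.

Import Order.TTheory GRing.Theory Num.Theory.
Local Open Scope ring_scope.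

(** * Nonnegative combinations of the quotients of a polynomial by its linear factors *)

Lemma poly_factor_out (F : fieldType) (P : pred F) (p : {poly F}) : p != 0 ->
  exists s g, [/\ p = g * \prod_(z <- s) ('X - z%:P), all P s &
    forall x, P x -> ~~ root g x].
Proof.
have [m] := ubnP (size p); elim: m p => // m IHm p ltpm p0.
have [[x [Px rx]]|nr] := pselect (exists x, P x /\ root p x); last first.
  exists [::], p; split=> //; first by rewrite big_nil mulr1.
  by move=> x Px; apply/negP => rx; apply: nr; exists x.
have [q pE] := factor_theorem _ _ rx.
have q0 : q != 0 by apply: contraNneq p0 => q0; rewrite pE q0 mul0r.
have [|s [g [qE sP gP]]] := IHm q _ q0.
  by move: ltpm; rewrite pE size_Mmonic ?monicXsubC// size_XsubC addn2.
by exists (x :: s), g; split=> //=; rewrite ?Px// big_cons pE qE mulrAC mulrA.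
Qed.

Lemma poly_pos_noroot (R : realType) (g : {poly R}) (a b : R) :
  (forall x, a <= x <= b -> ~~ root g x) -> 0 < g.[b] ->
  forall x, a <= x <= b -> 0 < g.[x].
Proof.
move=> nr gb x /andP[ax xb]; rewrite ltNge; apply/negP => gx.
have [|c cxb rc] := @poly_ivt R g x b xb; first by rewrite gx ltW.
have /andP[xc cb] := cxb.
by have := nr c; rewrite cb (le_trans ax xc) rc => /(_ isT).
Qed.

(* Induction removing the two largest roots y >= z of p = p' (X - y) (X - z).  If
   W' works for p' then W = (X - z)^2 W' works for p: for a root b <= z < y,
   (x - z) / ((x - y) (x - b)) has the nonnegative residues (z - b) / (y - b) at b
   and (y - z) / (y - b) at y. *)
Lemma sign_multiplier_sorted (R : realType) (g : {poly R}) (s : seq R) :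
  sorted >=%R s -> all (fun z : R => -1 <= z < 1) s -> last 0 s = -1 ->
  (forall x, -1 <= x <= 1 -> 0 < g.[x]) ->
  let p := g * \prod_(z <- s) ('X - z%:P) in
  let W x := fun w : seq (R * R) =>
    \sum_(q <- w) q.1 * (p %/ ('X - q.2%:P)).[x] in
  exists w, [/\ all (fun q => (0 <= q.1) && (q.2 \in s)) w,
    0 < W 1 w & forall x, -1 <= x <= 1 -> 0 <= W x w].
Proof.
move=> + + + gpos.
have quot (h : {poly R}) y : h * ('X - y%:P) %/ ('X - y%:P) = h.
  by rewrite mulpK// polyXsubC_eq0.
have [m] := ubnP (size s); elim: m s => // m IHm [|y [|z s]] /= ltsm.
(* The empty list is excluded by the default value: [last 0 [::]] is 0, not -1. *)
- by move=> _ _ /eqP; rewrite eq_sym oppr_eq0 oner_eq0.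
- move=> _ _ yE; exists [:: (1, y)]; split=> [||x x1].
  + by rewrite /= ler01 inE eqxx.
  + by rewrite big_seq1 mul1r /= big_seq1 quot gpos//; lra.
  + by rewrite big_seq1 mul1r /= big_seq1 quot ltW// gpos.
case: s ltsm => [|u s] ltsm.
(* Here [z] is -1, so dividing by [X - y] leaves [g * (X + 1)], nonnegative on [[-1, 1]]. *)
- move=> /andP[zy _] /and3P[y1 z1 _] zE; rewrite /= in zE.
  exists [:: (1, y)].
  have E : g * \prod_(z0 <- [:: y; z]) ('X - z0%:P) = g * ('X - z%:P) * ('X - y%:P).
    by rewrite big_cons big_seq1 mulrAC mulrA.
  split=> [||x x1].
  + by rewrite /= ler01 inE eqxx.
  + rewrite big_seq1 mul1r /= E quot !hornerE mulr_gt0//; last by lra.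
    by apply: gpos; lra.
  + rewrite big_seq1 mul1r /= E quot !hornerE mulr_ge0//; last by lra.
    by rewrite ltW// gpos.
set s' := u :: s => /andP[zy srt] /and3P[y1 z1 s1] lst.
have [||||w [wP w1 wpos]] := IHm s'.
- by move: ltsm => /=; rewrite !ltnS => /ltnW.
- by move: srt; apply: path_sorted.
- by [].
- by [].
have sz b : b \in s' -> b <= z.
  have tr : transitive (>=%R : rel R) by move=> ? ? ?; exact: ge_trans.
  by move: srt; rewrite (path_sortedE tr) => /andP[/allP h _] /h.
have E' b : b \in s' -> exists h : {poly R},
    g * \prod_(z <- s') ('X - z%:P) = h * ('X - b%:P).
  by move=> bs; rewrite (big_rem b)//= mulrCA mulrC; eexists.
have big2 : g * \prod_(z0 <- [:: y, z & s']) ('X - z0%:P) =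
    g * \prod_(z <- s') ('X - z%:P) * ('X - z%:P) * ('X - y%:P).
  by rewrite !big_cons; ring.
rewrite big2 /=; set p' := g * _ in w1 wpos big2 E' *.
suff [w2 [w2P w2W]] : exists w2, all (fun q : R * R => (0 <= q.1) && (q.2 \in [:: y, z & s'])) w2 /\
   forall x, \sum_(q <- w2) q.1 * (p' * ('X - z%:P) * ('X - y%:P) %/ ('X - q.2%:P)).[x]
    = (x - z) ^+ 2 * \sum_(q <- w) q.1 * (p' %/ ('X - q.2%:P)).[x].
  exists w2; split=> //.
  - by rewrite w2W mulr_gt0// exprn_gt0// subr_gt0; lra.
  - by move=> x x1; rewrite w2W mulr_ge0// ?sqr_ge0// wpos.
(* For equal roots [p] is [(X - z)^2 p'], so the old weights serve unchanged. *)
case: (eqVneq z y) => [->|zy'].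
  exists w; split.
    apply: sub_all wP => q /andP[-> /= qs].
    by rewrite !inE -in_cons; apply/orP; right; apply/orP; right.
  move=> x; rewrite mulr_sumr; apply: eq_big_seq => q qw.
  have /andP[_ qs] := allP wP q qw.
  have [h p'E] := E' _ qs.
  rewrite p'E quot.
  have -> : h * ('X - (q.2)%:P) * ('X - y%:P) * ('X - y%:P) =
   h * ('X - y%:P) * ('X - y%:P) * ('X - (q.2)%:P) by ring.
  by rewrite quot !(hornerM, hornerXsubC); ring.
have ltzy : z < y by rewrite lt_neqAle zy'.
pose w2 := (\sum_(q <- w) q.1 * (y - z) / (y - q.2), y) ::
   [seq (q.1 * (z - q.2) / (y - q.2), q.2) | q <- w].
have wq q : q \in w -> [/\ 0 <= q.1, q.2 \in s', q.2 <= z & 0 < y - q.2].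
  move=> qw; have /andP[q1 qs] := allP wP q qw.
  by split=> //; [exact: sz | rewrite subr_gt0 (le_lt_trans (sz _ qs))].
exists w2; split.
  rewrite /= inE eqxx andbT; apply/andP; split.
    rewrite big_seq_cond; apply: sumr_ge0 => q; rewrite andbT => /wq[q1 _ _ q2].
    by rewrite divr_ge0// ?(ltW q2)// mulr_ge0// subr_ge0.
  apply/allP => _ /mapP[q /wq[q1 qs qz q2] ->] /=.
  rewrite divr_ge0// ?(ltW q2)// ?mulr_ge0// ?subr_ge0//=.
  by rewrite !inE -in_cons; apply/orP; right; apply/orP; right.
move=> x; rewrite big_cons big_map mulr_suml mulr_sumr -big_split /=.
apply: eq_big_seq => q /wq[q1 qs qz q2].
have [h p'E] := E' _ qs.
rewrite p'E !quot.
have -> : h * ('X - (q.2)%:P) * ('X - z%:P) * ('X - y%:P) =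
   h * ('X - z%:P) * ('X - y%:P) * ('X - (q.2)%:P) by ring.
rewrite quot !(hornerM, hornerXsubC); field.
by rewrite gt_eqF.
Qed.

(** All roots in [[-1, 1)] are split off and sorted decreasingly, so that -1 comes last. The
    cofactor has no root in [[-1, 1)] and is positive at 1, hence positive on [[-1, 1]]. *)
Lemma sign_multiplier (R : realType) (p : {poly R}) :
  p.[-1] = 0 -> 0 < p.[1] ->
  exists w : seq (R * R), let W x :=
    \sum_(q <- w) q.1 * (p %/ ('X - q.2%:P)).[x] in
    [/\ forall q, q \in w -> [/\ 0 <= q.1, -1 <= q.2 < 1 & root p q.2],
      0 < W 1 & forall x, -1 <= x <= 1 -> 0 <= W x].
Proof.
move=> pN1 p1.
have p0 : p != 0 by apply: contraTneq p1 => ->; rewrite horner0 ltxx.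
have [s [g [pE sP gP]]] := poly_factor_out (fun z : R => -1 <= z < 1) p0.
pose t := sort >=%R s.
have tP : perm_eq t s by rewrite perm_sort.
rewrite -(perm_all _ tP) in sP.
move: pE; rewrite -(perm_big _ tP) /= => pE.
have prod_pos : 0 < (\prod_(z <- t) ('X - z%:P)).[1].
  rewrite horner_prod big_seq_cond prodr_gt0// => z; rewrite andbT => /(allP sP).
  by rewrite !hornerE; lra.
have g1 : 0 < g.[1] by move: p1; rewrite pE hornerM pmulr_lgt0.
have gpos x : -1 <= x <= 1 -> 0 < g.[x].
  move=> x1; apply: (@poly_pos_noroot R g (-1) 1) => // y /andP[y1 y2].
  move: y2; rewrite le_eqVlt => /orP[/eqP ->|y2]; last by apply: gP; lra.
  by rewrite rootE gt_eqF.
have srt : sorted >=%R t.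
  by apply: sort_sorted => x y; rewrite orbC le_total.
have N1t : -1 \in t.
  rewrite -root_prod_XsubC; move/eqP: pN1; rewrite pE hornerM mulf_eq0.
  by rewrite gt_eqF ?gpos//; lra.
have lst : last 0 t = -1.
  case/lastP: t srt N1t sP {tP pE prod_pos} => [//|t x].
  rewrite last_rcons => srt N1t sP; apply/eqP; rewrite eq_le.
  have := allP sP x; rewrite mem_rcons mem_head => /(_ isT) /andP[-> _].
  rewrite andbT; move: N1t; rewrite mem_rcons inE => /orP[/eqP <-//|N1t].
  have tr : transitive (>=%R : rel R) by move=> ? ? ?; exact: ge_trans.
  by move: srt; rewrite -cats1 sorted_pairwise// pairwise_cat allrel1r => /andP[/allP/(_ _ N1t)].
have [w []] := sign_multiplier_sorted srt sP lst gpos.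
rewrite -pE => wP w1 wpos; exists w; split=> // q qw.
have /andP[q1 qt] := allP wP _ qw.
split=> //; first exact: (allP sP).
by rewrite pE rootM root_prod_XsubC qt orbT.
Qed.

(** * Cosine sums at equispaced angles and the polynomials of the odd cosines *)

Lemma sin_natpi (R : realType) (l : nat) : sin (l%:R * pi) = 0 :> R.
Proof.
elim: l => [|l IHl]; first by rewrite mul0r sin0.
by rewrite -natr1 mulrDl mul1r sinDpi IHl oppr0.
Qed.

(** Lagrange's trigonometric identity, cleared of the denominator [sin a]. *)
Lemma sum_cos_even (R : realType) (a : R) (n : nat) :
  (\sum_(k < n) cos (2 * k%:R * a)) * sin a =
  sin (n%:R * a) * cos (n%:R * a - a).
Proof.
elim: n => [|n IHn]; first by rewrite big_ord0 !mul0r sin0 mul0r.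
rewrite big_ord_recr /= mulrDl IHn.
have -> : n.+1%:R * a - a = n%:R * a by rewrite -natr1; ring.
have -> : n.+1%:R * a = n%:R * a + a by rewrite -natr1; ring.
have -> : 2 * n%:R * a = n%:R * a + n%:R * a by ring.
rewrite cosB cosD sinD; have := cos2Dsin2 (n%:R * a); nra.
Qed.

(** For a = l pi / n the closed form has the factor sin (l pi) = 0, while [0 < l < n] keeps a
    strictly between 0 and pi, where sin a > 0. *)
Lemma sum_cos_equispaced (R : realType) (n l : nat) : (0 < l < n)%N ->
  \sum_(k < n) cos (2 * k%:R * (l%:R * pi / n%:R)) = 0 :> R.
Proof.
move=> /andP[l0 ln]; have n0 : 0 < n%:R :> R by rewrite ltr0n (leq_trans _ ln).
set a : R := l%:R * pi / n%:R.
have sa : 0 < sin a.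
  apply: sin_gt0_pi; rewrite divr_gt0 ?mulr_gt0 ?pi_gt0 ?(ltr0n _ l)//=.
  by rewrite ltr_pdivrMr// mulrC ltr_pM2l ?pi_gt0// ltr_nat.
have := sum_cos_even a n.
have -> : n%:R * a = l%:R * pi by rewrite /a; field; rewrite gt_eqF.
by rewrite sin_natpi mul0r => /eqP; rewrite mulf_eq0 (gt_eqF sa) orbF => /eqP.
Qed.

(* [1 + 'X] times the Chebyshev polynomial of the third kind. *)
Fixpoint cos_odd_poly (R : nzRingType) (j : nat) : {poly R} :=
  match j with
  | 0 => 1 + 'X
  | 1 => (1 + 'X) * ('X *+ 2 - 1)
  | (i.+1 as i').+1 => ('X * cos_odd_poly R i') *+ 2 - cos_odd_poly R i
  end.

Lemma cos_odd_polyS (R : nzRingType) (j : nat) : cos_odd_poly R j.+2 =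
  ('X * cos_odd_poly R j.+1) *+ 2 - cos_odd_poly R j.
Proof. by []. Qed.

Lemma nat_pair_ind (P : nat -> Prop) : P 0 -> P 1 ->
  (forall j, P j -> P j.+1 -> P j.+2) -> forall j, P j.
Proof.
move=> P0 P1 PS j; suff [] : P j /\ P j.+1 by [].
by elim: j => // j [Pj Pj1]; split=> //; exact: PS.
Qed.

(** Both sides obey f(j+2) = 2 cos(2t) f(j+1) - f(j). Zeros of [cosine_sum] thereby become roots of
    a polynomial in [cos (2 * t)]. *)
Lemma horner_cos_odd_poly (R : realType) (j : nat) (t : R) :
  (cos_odd_poly R j).[cos (2 * t)] = 2 * cos t * cos ((2 * j + 1)%:R * t).
Proof.
have c2 : cos (2 * t) = 2 * cos t ^+ 2 - 1 by rewrite mulr_natl cos_mulr2n; ring.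
have s2 : sin (2 * t) = 2 * sin t * cos t by rewrite mulr_natl sin_mulr2n; ring.
elim/nat_pair_ind: j => [||j IHj IHj1].
- have -> : (2 * 0 + 1)%:R * t = t by ring.
  by rewrite !(hornerD, hornerX, hornerC) c2; ring.
- rewrite /= !(hornerM, hornerD, hornerN, hornerX, hornerMn, hornerC).
  have -> : (2 * 1 + 1)%:R * t = 2 * t + t by ring.
  by rewrite cosD s2 c2; have := cos2Dsin2 t; nra.
rewrite cos_odd_polyS hornerD hornerN hornerMn hornerM hornerX IHj IHj1.
have -> : (2 * j.+2 + 1)%:R * t = (2 * j.+1 + 1)%:R * t + 2 * t by ring.
have -> : (2 * j + 1)%:R * t = (2 * j.+1 + 1)%:R * t - 2 * t by ring.
by rewrite cosB cosD; ring.
Qed.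

Lemma cos_odd_poly1 (R : comNzRingType) (j : nat) : (cos_odd_poly R j).[1] = 2.
Proof.
elim/nat_pair_ind: j => [||j IHj IHj1].
- by rewrite !hornerE.
- by rewrite /= !(hornerM, hornerD, hornerN, hornerX, hornerMn, hornerC); ring.
by rewrite cos_odd_polyS hornerD hornerN hornerMn hornerM hornerX IHj IHj1; ring.
Qed.

Lemma cos_odd_polyN1 (R : comNzRingType) (j : nat) : (cos_odd_poly R j).[-1] = 0.
Proof.
elim/nat_pair_ind: j => [||j IHj IHj1].
- by rewrite !hornerE; ring.
- by rewrite /= !(hornerM, hornerD, hornerN, hornerX, hornerMn, hornerC); ring.
by rewrite cos_odd_polyS hornerD hornerN hornerMn hornerM hornerX IHj IHj1; ring.
Qed.

(** * Divided differences and their sums over the nodes *)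

(** Subtracting [p.[y]] makes the division exact even when [y] is not a root. The operator is then
    linear and can be applied to each [cos_odd_poly] separately. *)
Definition divided_diff (F : fieldType) (y : F) (p : {poly F}) : {poly F} :=
  (p - p.[y]%:P) %/ ('X - y%:P).

Lemma divided_diffP (F : fieldType) (y : F) (p : {poly F}) :
  p = divided_diff y p * ('X - y%:P) + p.[y]%:P.
Proof.
rewrite divpK ?subrK// dvdp_XsubCl rootE hornerD hornerN hornerC.
by rewrite subrr.
Qed.

Lemma divided_diff_uniq (F : fieldType) (y : F) (p q : {poly F}) (c : F) :
  p = q * ('X - y%:P) + c%:P -> divided_diff y p = q.
Proof.
move=> ->; rewrite /divided_diff hornerD hornerM hornerXsubC subrr mulr0 hornerC.
by rewrite add0r addrK mulpK// polyXsubC_eq0.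
Qed.

Lemma divided_diff_linear (F : fieldType) (y : F) : linear (divided_diff y).
Proof.
move=> a p q; apply: (@divided_diff_uniq _ _ _ _ (a * p.[y] + q.[y])).
rewrite {1}(divided_diffP y p) {1}(divided_diffP y q) polyCD polyCM -!mul_polyC.
by ring.
Qed.

HB.instance Definition _ (F : fieldType) (y : F) :=
  GRing.isLinear.Build F {poly F} {poly F} *:%R (divided_diff y)
    (divided_diff_linear y).

(** The product rule for divided differences; it carries the three-term recurrence over to them. *)
Lemma divided_diffXM (F : fieldType) (y : F) (p : {poly F}) :
  divided_diff y ('X * p) = p + y *: divided_diff y p.
Proof.
apply: (@divided_diff_uniq _ _ _ _ (y * p.[y])).
rewrite {1 2}(divided_diffP y p) polyCM -!mul_polyC.
by ring.
Qed.

(** The real parts of the nth roots of unity, with the 2 kept outside so that [horner_cos_odd_poly]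
    applies at t = k pi / n. *)
Definition node (R : realType) (n k : nat) : R := cos (2 * (k%:R * pi / n%:R)).

(** The product 2 cos t cos (2j+3)t splits into cos (2j+2)t + cos (2j+4)t, and both frequencies
    average to zero over the nodes as j + 2 < n. *)
Lemma sum_node_cos_odd_poly (R : realType) (n j : nat) : (j.+2 < n)%N ->
  \sum_(k < n) (cos_odd_poly R j.+1).[node R n k] = 0.
Proof.
move=> jn; transitivity (\sum_(k < n) (cos (2 * k%:R * (j.+1%:R * pi / n%:R)) +
  cos (2 * k%:R * (j.+2%:R * pi / n%:R))) : R).
  apply: eq_bigr => k _; rewrite horner_cos_odd_poly; set t := _ * pi / _.
  have -> : 2 * k%:R * (j.+1%:R * pi / n%:R) = (2 * j.+1 + 1)%:R * t - t.
    by rewrite /t; ring.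
  have -> : 2 * k%:R * (j.+2%:R * pi / n%:R) = (2 * j.+1 + 1)%:R * t + t.
    by rewrite /t; ring.
  by rewrite cosB cosD; ring.
by rewrite big_split /= !sum_cos_equispaced ?addr0 ?jn// (ltnW jn).
Qed.

(** The divided differences satisfy d(j+2) = 2 P(j+1) + 2 y d(j+1) - d(j), with P(j) the polynomial
    [cos_odd_poly R j]. Summing over the nodes kills P(j+1), which leaves the recurrence of sin
    (2j+1)t. *)
Lemma sum_node_divided_diff (R : realType) (n j : nat) (t : R) : (j < n)%N ->
  sin t * \sum_(k < n) (divided_diff (cos (2 * t)) (cos_odd_poly R j)).[node R n k]
  = n%:R * sin ((2 * j + 1)%:R * t).
Proof.
have c2 : cos (2 * t) = 2 * cos t ^+ 2 - 1 by rewrite mulr_natl cos_mulr2n; ring.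
have s2 : sin (2 * t) = 2 * sin t * cos t by rewrite mulr_natl sin_mulr2n; ring.
set y := cos (2 * t).
have d0 : divided_diff y (cos_odd_poly R 0) = 1.
  apply: (@divided_diff_uniq _ _ _ _ (1 + y)) => /=.
  by rewrite polyCD mul1r; ring.
elim/nat_pair_ind: j => [jn||j IHj IHj1 jn].
- rewrite d0; under eq_bigr do rewrite hornerC.
  by rewrite sumr_const card_ord mul1r mulrC.
- move=> n1; have -> : cos_odd_poly R 1 =
      ('X * cos_odd_poly R 0) *+ 2 - cos_odd_poly R 0 by rewrite /=; ring.
  rewrite linearB linearMn /= -/(cos_odd_poly R 0) divided_diffXM d0.
  (* This relies on [1 < n]: for n = 1 the only node is 1. *)
  have S0 : \sum_(k < n) node R n k = 0.
    rewrite -[RHS](@sum_cos_equispaced R n 1)// /node.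
    by apply: eq_bigr => k _; congr cos; ring.
  rewrite (eq_bigr (fun k : 'I_n => 2 * node R n k + (2 * y + 1))); last first.
    move=> k _; rewrite !(hornerD, hornerN, hornerMn, hornerZ, hornerC, hornerX).
    by ring.
  rewrite big_split /= -mulr_sumr S0 sumr_const card_ord -mulr_natr.
  have -> : (2 * 1 + 1)%:R * t = 2 * t + t by ring.
  rewrite sinD s2 /y c2; ring.
rewrite cos_odd_polyS linearB linearMn /= divided_diffXM.
set dj1 := divided_diff y _; set dj := divided_diff y _.
rewrite (eq_bigr (fun k : 'I_n => 2 * (cos_odd_poly R j.+1).[node R n k] +
  2 * y * dj1.[node R n k] - dj.[node R n k])); last first.
  by move=> k _; rewrite !(hornerD, hornerN, hornerMn, hornerZ); ring.
rewrite sumrB big_split /= -!mulr_sumr sum_node_cos_odd_poly// mulr0 add0r.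
have jn1 := ltnW jn; have := IHj (ltnW jn1); have := IHj1 jn1.
rewrite -/dj -/dj1 => HA HB; rewrite mulrBr HB mulrCA HA.
have -> : (2 * j.+2 + 1)%:R * t = (2 * j.+1 + 1)%:R * t + 2 * t by ring.
have -> : (2 * j + 1)%:R * t = (2 * j.+1 + 1)%:R * t - 2 * t by ring.
by rewrite sinB sinD /y; ring.
Qed.

(** * The lower bound *)

Lemma horner_comb_cos_odd_poly (R : realType) (n : nat) (a : 'rV[R]_n) (t : R) :
  (\sum_(j < n) a ord0 j *: cos_odd_poly R j).[cos (2 * t)] =
  2 * cos t * cosine_sum a t.
Proof.
rewrite horner_sum mulr_sumr; apply: eq_bigr => j _.
by rewrite hornerZ horner_cos_odd_poly mulrCA.
Qed.

Lemma max_sine_ge (R : realType) (n : nat) (a : 'rV[R]_n) : (0 < n)%N ->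
  \sum_(j < n) a ord0 j = 1 -> 1 / n%:R <= max_sine a.
Proof.
move=> n0 a1; set mu := max_sine a.
have n0R : 0 < n%:R :> R by rewrite ltr0n.
have [_ mu_ub] := max_sineP a.
pose p := \sum_(j < n) a ord0 j *: cos_odd_poly R j.
have p1 : p.[1] = 2.
  rewrite horner_sum; under eq_bigr do rewrite hornerZ cos_odd_poly1.
  by rewrite -mulr_suml a1 mul1r.
have pN1 : p.[-1] = 0.
  by rewrite horner_sum big1// => j _; rewrite hornerZ cos_odd_polyN1 mulr0.
pose Q y := p %/ ('X - y%:P).
have node_le1 k : -1 <= node R n k <= 1 by rewrite cos_geN1 cos_le1.
have Qroot y : -1 <= y < 1 -> root p y ->
    \sum_(k < n) (Q y).[node R n k] <= n%:R * (mu * (Q y).[1]).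
  move=> /andP[yN1 y1] /eqP py.
  (* This choice gives cos 2t = y; [y < 1] makes t, and hence sin t, positive. *)
  pose t := acos y / 2.
  have y11 : -1 <= y <= 1 by rewrite yN1 ltW.
  have yE : cos (2 * t) = y by rewrite /t mulrC divfK// acosK// in_itv.
  have t_gt0 : 0 < t by rewrite divr_gt0// acos_gt0// yN1.
  have t_le : t <= pi / 2 by rewrite ler_pM2r// acos_lepi.
  have s0 : 0 < sin t.
    apply: sin_gt0_pi; rewrite t_gt0 (le_lt_trans t_le)//.
    by have := pi_gt0 R; lra.
  have y_sin : 1 - y = 2 * sin t ^+ 2.
    by rewrite -yE mulr_natl cos_mulr2n sin2cos2; ring.
  have QE : Q y = divided_diff y p by rewrite /divided_diff py subr0.
  have C0 : cosine_sum a t = 0.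
    have := horner_comb_cos_odd_poly a t; rewrite -/p yE py => /esym/eqP.
    (* The extra factor cos t adds no spurious root: it vanishes only at pi/2, itself a zero of
       C. *)
    rewrite mulf_eq0 mulf_eq0 pnatr_eq0/= => /orP[/eqP ct|/eqP//].
    suff -> : t = pi / 2 by exact: cosine_sum_pihalf.
    apply/eqP; rewrite eq_le t_le/= leNgt; apply/negP => t_lt.
    have : 0 < cos t by apply: cos_gt0_pihalf; lra.
    by rewrite ct ltxx.
  have St : sine_values a `|sine_sum a t|.
    by exists t => //; split=> //; rewrite ltW.
  have S_le : sine_sum a t <= mu.
    apply: le_trans (ler_norm _) _; exact: mu_ub.
  have mu0 : 0 <= mu.
    by apply: le_trans (normr_ge0 (sine_sum a t)) _; exact: mu_ub.
  have S_sum : sin t * \sum_(k < n) (Q y).[node R n k] = n%:R * sine_sum a t.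
    rewrite QE /p linear_sum; under eq_bigr do rewrite horner_sum.
    rewrite exchange_big !mulr_sumr; apply: eq_bigr => j _.
    rewrite linearZ; under eq_bigr do rewrite hornerZ.
    rewrite -mulr_sumr mulrCA -yE sum_node_divided_diff//.
    by rewrite mulrCA.
  (* Evaluating p = Q (X - y) at 1 gives 2 = Q(1) (1 - y) = 2 Q(1) sin^2 t. *)
  have Q1 : sin t ^+ 2 * (Q y).[1] = 1.
    have := divided_diffP y p; rewrite -QE py addr0 => /(congr1 (horner^~ 1)).
    by rewrite hornerM hornerXsubC p1 y_sin; lra.
  rewrite -(ler_pM2l s0) S_sum mulrCA ler_pM2l//.
  apply: le_trans S_le _.
  have -> : sin t * (mu * (Q y).[1]) = mu * (sin t * (Q y).[1]) by ring.
  apply: ler_peMr => //.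
  rewrite -(ler_pM2l s0) mulr1 mulrA -expr2 Q1.
  exact: sin_le1.
have [|w [wP w1 wpos]] := sign_multiplier pN1; first by rewrite p1.
set W : R -> R := fun x => \sum_(q <- w) q.1 * (Q q.2).[x] in w1 wpos.
have W1_le : W 1 <= \sum_(k < n) W (node R n k).
  rewrite (bigD1 (Ordinal n0))//=.
  have -> : node R n 0 = 1 by rewrite /node !mul0r mulr0 cos0.
  by rewrite lerDl; apply: sumr_ge0 => k _; apply: wpos; exact: node_le1.
have W_le : \sum_(k < n) W (node R n k) <= n%:R * (mu * W 1).
  rewrite exchange_big /W !mulr_sumr big_seq [leRHS]big_seq.
  apply: ler_sum => q /wP[q0 q1 rq]; rewrite -mulr_sumr.
  have -> : n%:R * (mu * (q.1 * (Q q.2).[1])) = q.1 * (n%:R * (mu * (Q q.2).[1])).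
    by ring.
  by rewrite ler_wpM2l// Qroot.
rewrite ler_pdivrMr// -(ler_pM2r w1) mul1r.
by apply: le_trans W1_le (le_trans W_le _); rewrite mulrA [n%:R * _]mulrC.
Qed.

(** * The upper bound: linearly decreasing weights and their perturbation *)

(** Passing from n to n + 1 raises every old weight by 2 and appends the weight 1. The raise
    contributes twice the sum of the odd cosines, which [odd_sum] telescopes to sin (2nt) / sin
    t. *)
Lemma fejer_cosine_sum (R : realType) (n : nat) (t : R) :
  sin t ^+ 2 * (\sum_(j < n) (2 * (n%:R - j%:R) - 1) * cos ((2 * j + 1)%:R * t)) =
  cos t * sin (n%:R * t) ^+ 2.
Proof.
have odd_sum m : 2 * sin t * (\sum_(j < m) cos ((2 * j + 1)%:R * t)) =
    sin (2 * m%:R * t).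
  elim: m => [|m IHm]; first by rewrite big_ord0 !(mulr0, mul0r) sin0.
  rewrite big_ord_recr mulrDr IHm /=.
  have -> : 2 * m.+1%:R * t = (2 * m + 1)%:R * t + t by ring.
  have -> : 2 * m%:R * t = (2 * m + 1)%:R * t - t by ring.
  by rewrite sinB sinD; ring.
elim: n => [|n IHn]; first by rewrite big_ord0 mul0r sin0 mulr0 expr0n mulr0.
rewrite big_ord_recr /=.
rewrite (eq_bigr (fun j : 'I_n => (2 * (n%:R - j%:R) - 1) *
  cos ((2 * j + 1)%:R * t) + 2 * cos ((2 * j + 1)%:R * t))); last first.
  by move=> j _; ring.
rewrite big_split /= -mulr_sumr 2!mulrDr IHn.
have -> : sin t ^+ 2 * (2 * \sum_(j < n) cos ((2 * j + 1)%:R * t)) =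
    sin t * sin (2 * n%:R * t) by rewrite -odd_sum; ring.
set u := n%:R * t.
have -> : n.+1%:R * t = u + t by rewrite /u; ring.
have -> : 2 * n%:R * t = u + u by rewrite /u; ring.
have -> : (2 * n + 1)%:R * t = u + (u + t) by rewrite /u; ring.
have -> : 2 * (n.+1%:R - n%:R) - 1 = 1 :> R by ring.
rewrite !(sinD, cosD).
apply/eqP; rewrite -subr_eq0; apply/eqP.
transitivity ((1 - (cos t ^+ 2 + sin t ^+ 2)) *
  (cos t * sin u ^+ 2 + 2 * sin t * sin u * cos u)); first by ring.
by rewrite cos2Dsin2 subrr mul0r.
Qed.

(** The sines at pi/2 alternate as [(-1) ^+ j], so going from n to n + 1 adds (1 - (-1)^n) + (-1)^n
    = 1. *)
Lemma fejer_sine_sum_pihalf (R : realType) (n : nat) :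
  \sum_(j < n) (2 * (n%:R - j%:R) - 1) * sin ((2 * j + 1)%:R * (pi / 2)) =
  n%:R :> R.
Proof.
have sinE j : sin ((2 * j + 1)%:R * (pi / 2)) = (-1) ^+ j :> R.
  elim: j => [|j IHj]; first by rewrite mul1r sin_pihalf expr0.
  have -> : (2 * j.+1 + 1)%:R * (pi / 2) = (2 * j + 1)%:R * (pi / 2) + pi :> R.
    by field.
  by rewrite sinDpi IHj exprS mulN1r.
have alt m : 2 * (\sum_(j < m) (-1) ^+ j) = 1 - (-1) ^+ m :> R.
  elim: m => [|m IHm]; first by rewrite big_ord0 mulr0 subrr.
  by rewrite big_ord_recr mulrDr IHm exprS; ring.
elim: n => [|n IHn]; first by rewrite big_ord0.
rewrite big_ord_recr /= sinE.
rewrite (eq_bigr (fun j : 'I_n => (2 * (n%:R - j%:R) - 1) *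
  sin ((2 * j + 1)%:R * (pi / 2)) + 2 * (-1) ^+ j)); last first.
  by move=> j _; rewrite sinE; ring.
by rewrite big_split /= IHn -mulr_sumr alt; ring.
Qed.

Lemma fejer_weight_sum (R : realType) (n : nat) :
  \sum_(j < n) (2 * (n%:R - j%:R) - 1) = n%:R ^+ 2 :> R.
Proof.
elim: n => [|n IHn]; first by rewrite big_ord0 expr0n.
rewrite big_ord_recr /=.
rewrite (eq_bigr (fun j : 'I_n => (2 * (n%:R - j%:R) - 1) + 2)); last first.
  by move=> j _; ring.
by rewrite big_split /= IHn sumr_const card_ord -mulr_natr; ring.
Qed.

(** The weights are the odd numbers 2n - 1, ..., 3, 1 divided by their sum. *)
Definition fejer_row (R : realType) (n : nat) : 'rV[R]_n :=
  \row_j ((2 * (n%:R - j%:R) - 1) / n%:R ^+ 2).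

Lemma cosine_sum_fejer_row_ge0 (R : realType) (n : nat) (t : R) :
  0 <= t < pi / 2 -> 0 <= cosine_sum (fejer_row R n) t.
Proof.
move=> /andP[t0 tpi].
have -> : cosine_sum (fejer_row R n) t = (\sum_(j < n)
    (2 * (n%:R - j%:R) - 1) * cos ((2 * j + 1)%:R * t)) / n%:R ^+ 2.
  by rewrite mulr_suml; apply: eq_bigr => j _; rewrite mxE mulrAC.
rewrite divr_ge0 ?exprn_ge0//.
(* At t = 0 the factor sin^2 t cannot be cancelled, but there the sum is the total weight. *)
move: t0; rewrite le_eqVlt => /orP[/eqP <-|t0].
  under eq_bigr do rewrite mulr0 cos0 mulr1.
  by rewrite fejer_weight_sum exprn_ge0.
have s0 : 0 < sin t by apply: sin_gt0_pihalf; rewrite t0.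
rewrite -(pmulr_rge0 _ (exprn_gt0 2 s0)) fejer_cosine_sum.
rewrite mulr_ge0 ?sqr_ge0// ltW// cos_gt0_pihalf//.
by have := pi_gt0 R; lra.
Qed.

(** Adding e cos t to the nonnegative cosine sum makes it positive on [0, pi/2), so pi/2 is the only
    zero left. Renormalising by 1 + e gives the value (1/n + e) / (1 + e) there. *)
Lemma max_sine_perturbed (R : realType) (n : nat) (e : R) : (0 < n)%N -> 0 < e ->
  exists2 a : 'rV[R]_n, \sum_(j < n) a ord0 j = 1 & max_sine a <= 1 / n%:R + e.
Proof.
move=> n0 e0; have n0R : 0 < n%:R :> R by rewrite ltr0n.
pose b : 'rV[R]_n := delta_mx ord0 (Ordinal n0).
pose a := (1 + e)^-1 *: (fejer_row R n + e *: b).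
have e1 : 0 < 1 + e by rewrite addr_gt0.
have suma (f : nat -> R) : \sum_(j < n) a ord0 j * f j =
    (1 + e)^-1 * (\sum_(j < n) fejer_row R n ord0 j * f j + e * f 0%N).
  have -> : f 0%N = \sum_(j < n) b ord0 j * f j.
    rewrite (bigD1 (Ordinal n0))//= mxE !eqxx mul1r big1 ?addr0// => j jn.
    by rewrite mxE (negPf jn) andbF mul0r.
  rewrite mulr_sumr -big_split mulr_sumr; apply: eq_bigr => j _.
  have -> : a ord0 j = (1 + e)^-1 * (fejer_row R n ord0 j + e * b ord0 j).
    by rewrite !mxE.
  by rewrite /=; ring.
have a1 : \sum_(j < n) a ord0 j = 1.
  under eq_bigr do rewrite -[a _ _]mulr1.
  rewrite (suma (fun=> 1)) mulr1.
  under eq_bigr do rewrite mulr1 mxE.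
  by rewrite -mulr_suml fejer_weight_sum divff ?mulVf ?expf_neq0// gt_eqF.
exists a => //.
have [[t [/andP[t0 tpi] Ct] <-] _] := max_sineP a.
have tE : t = pi / 2.
  apply/eqP; rewrite eq_le tpi /= leNgt; apply/negP => tlt.
  have := suma (fun j => cos ((2 * j + 1)%:R * t)).
  rewrite -/(cosine_sum a t) Ct -/(cosine_sum _ t) mul1r => /esym/eqP.
  rewrite mulf_eq0 invr_eq0 gt_eqF//= gt_eqF//.
  rewrite ltr_wpDl ?cosine_sum_fejer_row_ge0 ?t0// mulr_gt0//.
  by apply: cos_gt0_pihalf; have := pi_gt0 R; lra.
have -> : sine_sum a t = (1 + e)^-1 * (1 / n%:R + e).
  rewrite /sine_sum (suma (fun j => sin ((2 * j + 1)%:R * t))) tE.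
  rewrite !mul1r sin_pihalf mulr1; congr (_ * (_ + _)).
  under eq_bigr do rewrite mxE mulrAC.
  by rewrite -mulr_suml fejer_sine_sum_pihalf; field; rewrite gt_eqF.
have q0 : 0 < 1 / n%:R + e by rewrite addr_gt0// divr_gt0.
rewrite ger0_norm; last by rewrite mulr_ge0 ?ltW// invr_gt0.
by rewrite ler_piMl ?(ltW q0)// invf_le1// lerDl ltW.
Qed.

Theorem theorem3 (R : realType) (n : nat) (hn : (1 <= n)%N) :
  J2 R n = 1 / n%:R.
Proof.
apply/eqP; rewrite eq_le; apply/andP; split.
  apply/ler_addgt0Pr => e e0.
  have [a a1 ae] := @max_sine_perturbed R n e hn e0.
  apply: le_trans ae; apply: ge_inf; last by exists a.
  by exists (1 / n%:R) => _ [c c1 <-]; exact: max_sine_ge.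
apply: lb_le_inf; last by move=> _ [c c1 <-]; exact: max_sine_ge.
(* Only nonemptiness of the set is at stake here, so the value 1 for [e] is arbitrary. *)
have [a a1 _] := @max_sine_perturbed R n 1 hn ltr01.
by exists (max_sine a), a.
Qed.
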